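(* Let $G=(V,E)$ be a finite graph with barycentric subdivision $G^*$. Then $G$ is a string graph if and only if there exists a drawing of $G^*$ in the plane, i.e. a continuous map $g:G^*\to\mathbb{R}^2$, such that $$g(v\alpha)\cap g(w\beta)=\emptyset$$ for every $(v\alpha,w\beta)\in P_{\mathrm{sd}}(G)$.
   Context: **Graphs.** A graph $G=(V,E)$ is finite, with vertex set $V$ and edge set $E$, each edge being a set of exactly two vertices; $vw$ abbreviates $\{v,w\}$. When a graph is the domain of a map, it denotes its geometric realization (a point for each vertex, a line segment for each edge, glued at endpoints), and the image of an edge is the image of the corresponding (closed) segment. **String graphs.** $G=(V,E)$ is a string graph if there are sets $\gamma_v\subseteq\mathbb{R}^2$ ($v\in V$), each the image of a continuous map $[0,1]\to\mathbb{R}^2$, such that for any two vertices $v\ne w$: $\gamma_v\cap\gamma_w\neq\emptyset$ if and only if $vw\in E$. **Barycentric subdivision.** $G^*$ is the graph with $V(G^* )=V\cup E$ and $E(G^* )=\{v\alpha : v\in\alpha\in E\}$, where $v\alpha$ denotes the edge $\{v,\alpha\}$ of $G^*$ joining the vertex $v\in V$ to the vertex $\alpha\in E$. **Forbidden pairs.** $P_{\mathrm{sd}}(G)=\{(v\alpha,w\beta)\in E(G^* )^2 : v\ne w \text{ and } vw\notin E\}$, where $v\in\alpha\in E$ and $w\in\beta\in E$. *)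

(* Defs.v *)
From HB Require Import structures.
From mathcomp Require Import all_boot all_order all_algebra.
From mathcomp Require Import all_classical all_reals all_analysis.

Set Implicit Arguments.
Unset Strict Implicit.
Unset Printing Implicit Defensive.

Import Order.TTheory GRing.Theory Num.Theory.
Import numFieldNormedType.Exports.

Local Open Scope ring_scope.
Local Open Scope classical_set_scope.

Record graph := Graph {
  vertex :> finType;
  edges : {set {set vertex}};
  edges_card2 : forall e : {set vertex}, e \in edges -> #|e| = 2%N }.

Definition edge (G : graph) : finType := {e : {set G} | e \in edges G}.

(* [V -> R] with the product topology is R^V. The cell of [A] is the convex
   hull of the basis vectors of R^V indexed by [A]: the basis vector of [v] if
   [A] is {v}, the closed line segment joining the basis vectors of [v] and
   [w] if [A] is {v, w} with [v] and [w] distinct. *)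
Definition cell (R : realType) (V : finType) (A : {set V}) :
    set {ptws V -> R} :=
  [set x | [/\ forall u, 0 <= x u, forall u, u \notin A -> x u = 0
             & \sum_(u : V) x u = 1]].

(* The segments of two distinct edges of [G] meet in R^V only at the point of a
   common endpoint, so this union with the subspace topology is the space
   obtained by gluing the segments at their endpoints. *)
Definition realization (R : realType) (G : graph) : set {ptws G -> R} :=
  [set x | (exists v : G, cell [set v]%SET x) \/
           (exists2 e : {set G}, e \in edges G & cell e x)].
Arguments realization R G : clear implicits.

Definition is_curve (R : realType) (A : set (R * R)) : Prop :=
  exists2 c : R -> R * R, {within `[0, 1], continuous c} & A = c @` `[0, 1].

Definition string_graph (R : realType) (G : graph) : Prop :=
  exists gamma : G -> set (R * R),
    (forall v, is_curve (gamma v)) /\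
    (forall v w : G, v <> w ->
       gamma v `&` gamma w !=set0 <-> [set v; w]%SET \in edges G).

Section BarycentricSubdivision.
Variable G : graph.

Definition sd_vertex : finType := (G + edge G)%type.

Definition sd_edge (v : G) (a : edge G) : {set sd_vertex} :=
  [set inl v; inr a]%SET.

Definition sd_edges : {set {set sd_vertex}} :=
  [set sd_edge v a | a in [set: edge G]%SET, v in val a]%SET.

Lemma sd_edges_card2 (e : {set sd_vertex}) : e \in sd_edges -> #|e| = 2%N.
Proof. by case/imset2P=> a v _ _ ->; rewrite cards2. Qed.

Definition subdivision : graph := Graph sd_edges_card2.

Definition sd_pairs : set ({set subdivision} * {set subdivision}) :=
  [set p | exists (v w : G) (a b : edge G),
     [/\ p = (sd_edge v a, sd_edge w b), v \in val a, w \in val b,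
         v <> w & [set v; w]%SET \notin edges G]].

End BarycentricSubdivision.

(* Main.v *)
Require Import Defs.
From HB Require Import structures.
From mathcomp Require Import all_boot all_order all_algebra.
From mathcomp Require Import all_classical all_reals all_analysis.
From mathcomp Require Import lra.
Import Order.TTheory GRing.Theory Num.Theory.
Import numFieldNormedType.Exports.
Local Open Scope ring_scope.
Local Open Scope classical_set_scope.

Set Implicit Arguments.
Unset Strict Implicit.
Unset Printing Implicit Defensive.

(** In the subdivision, the edges [v a] with [v] fixed form a star centred at
    [v], and the stars of [v] and [w] share the point [a] when [a] is the edge
    between [v] and [w].  The pairs in [sd_pairs] are exactly the pairs of
    segments lying in the stars of distinct non-adjacent vertices.  So both
    directions exchange the string of [v] for the image of the star of [v].

    From strings to a drawing ([string_graph_drawing]): parametrize the string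
    of [v] by [c v] and choose for every edge [a] between [v] and [w] a point
    [p a] common to the two strings.  The segment [v a] is drawn along the
    string of [v], from [c v 0] to [p a].  Instead of pasting segments together
    along their common endpoints, [drawing_along_strings] gives one formula in
    the barycentric coordinates that is continuous on the whole ambient space.

    From a drawing to strings ([drawing_string_graph]): the star of [v] is the
    image of a path that walks out and back along each of its segments in turn
    ([star_path]), so its image under the drawing is a curve.  Two such curves
    meet if and only if the vertices are adjacent.  An isolated vertex has an
    empty star, and the drawing may put that vertex on top of any curve; its
    string is instead taken to be a point of its own to the right of the images
    of all the stars, which are bounded. *)

(** * Continuity *)

Lemma continuous_comp_within (T U V : topologicalType) (A : set U)
    (f : T -> U) (g : U -> V) :
  continuous f -> (forall t, A (f t)) -> {within A, continuous g} ->
  continuous (g \o f).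
Proof.
move=> fC fA /subspace_continuousP gC t B /(gC _ (fA t)) /= wB.
have tB := fC t _ wB.
exact: (filterS (fun s h => h (fA s)) tB).
Qed.

(** The product topology is the supremum of the initial topologies of the
    coordinates. *)
Lemma continuous_ptws (T V : topologicalType) (I : Type)
    (f : T -> {ptws I -> V}) :
  (forall i, continuous (fun t => f t i)) -> continuous f.
Proof.
move=> fC t; apply/cvg_sup => i.
exact: (@continuous_comp_initial {ptws I -> V} T V (fun h => h i) f (fC i)).
Qed.

Lemma continuous_coord (R : realType) (I : eqType) (i : I) :
  continuous (fun x : {ptws I -> R} => x i).
Proof. exact: (@proj_continuous I (fun=> R) i). Qed.

Lemma continuous_lincomb (R : realType) (T : topologicalType) (I : finType)
    (V : normedModType R) (s : I -> T -> R) (f : I -> T -> V) :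
  (forall i, continuous (s i)) -> (forall i, continuous (f i)) ->
  continuous (fun x => \sum_i s i x *: f i x).
Proof.
move=> sC fC; apply: continuous_big => [|i _ x]; first exact: add_continuous.
exact: cvgZ (sC i x) (fC i x).
Qed.

(** * Piecewise linear functions *)

Section PiecewiseLinear.
Context {R : realType}.

Definition clamp (y : R) : R := Num.max 0 (Num.min y 1).

Lemma clamp_itv y : `[0, 1]%classic (clamp y).
Proof.
by rewrite /= in_itv /= /clamp le_max lexx ge_max ler01 ge_min lexx orbT.
Qed.

Lemma clamp_id y : 0 <= y <= 1 -> clamp y = y.
Proof. by move=> /andP[y0 y1]; rewrite /clamp min_l // max_r. Qed.

Lemma clamp_continuous : continuous clamp.
Proof.
move=> y; have H := @continuous_max R R (fun=> 0) (fun z => Num.min z 1) y.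
apply: H; first exact: cvg_cst.
have K := @continuous_min R R id (fun=> 1) y.
by apply: K; [exact: cvg_id|exact: cvg_cst].
Qed.

(** Rises from 0 to 1 on [[0, 1/2]], falls back to 0 on [[1/2, 1]]: one trip
    out and back along a segment of length 1. *)
Definition tent (y : R) : R := Num.max 0 (1 - `|y *+ 2 - 1|).

Lemma tent_continuous : continuous tent.
Proof.
move=> y.
have H := @continuous_max R R (fun=> 0) (fun z => 1 - `|z *+ 2 - 1|) y.
apply: H; first exact: cvg_cst.
apply: cvgB; first exact: cvg_cst.
by apply: cvg_norm; apply: cvgB; [apply: cvgMn; exact: cvg_id|exact: cvg_cst].
Qed.

Lemma tent_ge0 y : 0 <= tent y.
Proof. by rewrite /tent le_max lexx. Qed.

Lemma tent_le1 y : tent y <= 1.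
Proof. by rewrite /tent ge_max ler01 /= gerBl. Qed.

Lemma tent_neq0 y : tent y != 0 -> 0 < y < 1.
Proof.
move=> y0; have : 0 < tent y by rewrite lt_def y0 tent_ge0.
by rewrite /tent lt_max ltxx subr_gt0 ltr_norml mulr2n => /andP[? ?]; lra.
Qed.

Lemma tent_half s : 0 <= s <= 1 -> tent (s / 2) = s.
Proof.
move=> /andP[s0 s1]; rewrite /tent mulr2n -splitr ler0_norm ?max_r; lra.
Qed.

(** Reaches 1 already at [1/2], so that of two barycentric coordinates with sum
    1 at least one is sent to 1, while 0 is still sent to 0. *)
Definition ramp (y : R) : R := Num.min (y *+ 2) 1.

Lemma ramp_continuous : continuous ramp.
Proof.
move=> y; have H := @continuous_min R R (fun z => z *+ 2) (fun=> 1) y.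
by apply: H; [apply: cvgMn; exact: cvg_id|exact: cvg_cst].
Qed.

Lemma ramp0 : ramp 0 = 0.
Proof. by rewrite /ramp mul0rn min_l. Qed.

Lemma ramp_or y z : y + z = 1 -> ramp y = 1 \/ ramp z = 1.
Proof.
move=> yz; case: (lerP (1/2) y) => h; [left|right];
  by rewrite /ramp min_r // mulr2n; lra.
Qed.
End PiecewiseLinear.

(** * Curves *)

Lemma is_curve_path (R : realType) (c : R -> R * R) :
  continuous c -> is_curve (c @` `[0, 1]).
Proof. by move=> cC; exists c => //; exact: continuous_subspaceT. Qed.

(** Precomposing with [clamp] extends a curve to a parametrization that is
    continuous on the whole line and has the same image; this removes all side
    conditions on the parameter. *)
Lemma is_curve_range_line (R : realType) (A : set (R * R)) :
  is_curve A -> exists2 c : R -> R * R, continuous c & A = range c.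
Proof.
case=> c cC ->; exists (c \o clamp).
  apply: continuous_comp_within cC; first exact: clamp_continuous.
  exact: clamp_itv.
apply/seteqP; split=> [_ [t t01 <-]|_ [t _ <-]].
  by exists t => //=; rewrite clamp_id //; move: t01; rewrite /= in_itv.
by exists (clamp t) => //; exact: clamp_itv.
Qed.

Lemma is_curve_bounded (R : realType) (A : set (R * R)) :
  is_curve A -> exists M, forall p, A p -> p.1 <= M.
Proof.
case=> c cC ->.
have fC : {within `[0, 1], continuous (fst \o c)}.
  by move=> t; apply: (cvg_comp _ _ (cC t)); exact: cvg_fst.
have [t _ tM] := EVT_max ler01 fC.
by exists (c t).1 => _ [s s01 <-]; exact: tM.
Qed.

(** * Edges *)

Lemma edge_ends (G : graph) (a : edge G) :
  exists v w, [/\ v <> w, val a = [set v; w]%SET & [set v; w]%SET \in edges G].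
Proof.
case: a => e eG /=; have /eqP/cards2P[v [w [vw eE]]] := edges_card2 eG.
by exists v, w; split; [exact/eqP| |rewrite -eE].
Qed.

Lemma cell_pairP (R : realType) (V : finType) (v w : V) (x : {ptws V -> R}) :
  v != w ->
  cell [set v; w]%SET x <->
  [/\ 0 <= x v, 0 <= x w, x v + x w = 1
    & forall u, u != v -> u != w -> x u = 0].
Proof.
move=> vw; have sumE : (forall u, u != v -> u != w -> x u = 0) ->
    \sum_u x u = x v + x w.
  move=> x0; rewrite (bigD1 v) //= (bigD1 w) /=; last by rewrite eq_sym.
  by rewrite big1 ?addr0 // => u /andP[uv uw]; exact: x0.
split=> [[x_ge0 x0 x1]|[xv xw x1 x0]].
  have x0' u : u != v -> u != w -> x u = 0.
    by move=> uv uw; apply: x0; rewrite !inE negb_or uv.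
  by split; rewrite // -?sumE.
split; rewrite ?sumE // => u; last first.
  by rewrite !inE negb_or => /andP[]; exact: x0.
have [->//|uv] := eqVneq u v; have [->//|uw] := eqVneq u w.
by rewrite x0.
Qed.

(** * From strings to a drawing *)

(** With [y a] the ramp of the coordinate of [a], the drawing is
      [q + sum_v ramp (x v) (c v (sum_a y a * t v a) - q)]
    where [q = sum_a y a * p a].  On the segment [v a] only the terms of [v] and
    [a] survive.  On its half near [v] the factor [ramp (x v)] is 1, and the
    value is [c v (y a * t v a)].  On its half near [a] the coefficient [y a] is
    1, the difference vanishes because [c v (t v a) = p a], and the value is
    [p a]. *)
Lemma drawing_along_strings (R : realType) (G : graph) (c : G -> R -> R * R)
    (p : edge G -> R * R) (t : G -> edge G -> R) :
  (forall v, continuous (c v)) ->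
  (forall v (a : edge G), v \in val a -> c v (t v a) = p a) ->
  exists2 g : {ptws subdivision G -> R} -> R * R,
    continuous g &
    forall (v : G) (a : edge G), v \in val a ->
      g @` cell (sd_edge v a) `<=` range (c v).
Proof.
move=> cC cp.
pose y (a : edge G) (x : {ptws subdivision G -> R}) := ramp (x (inr a)).
pose q x := \sum_a y a x *: p a.
pose g x := q x + \sum_v ramp (x (inl v)) *:
  (c v (\sum_a y a x * t v a) - q x).
have rC (u : subdivision G) :
    continuous (fun x : {ptws subdivision G -> R} => ramp (x u)).
  move=> x; apply: (cvg_comp (fun x : {ptws subdivision G -> R} => x u) ramp).
    exact: continuous_coord.
  exact: ramp_continuous.
have yC a : continuous (y a) by exact: rC.
have qC : continuous q.
  apply: (continuous_lincomb (V := (R * R)%type) (s := y)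
    (f := fun a _ => p a)).
    exact: yC.
  by move=> a; exact: cst_continuous.
have tC v : continuous (fun x => \sum_a y a x * t v a).
  apply: (continuous_lincomb (V := R^o) (s := y) (f := fun a _ => t v a)).
    exact: yC.
  by move=> a; exact: cst_continuous.
exists g.
  have dC v : continuous (fun x => c v (\sum_a y a x * t v a) - q x).
    have ctC : continuous (c v \o (fun x => \sum_a y a x * t v a)).
      by move=> x; apply: continuous_comp; [exact: tC|exact: cC].
    by move=> x; have B := cvgB (ctC x) (qC x); exact: B.
  have sC := continuous_lincomb (fun v => rC (inl v)) dC.
  by move=> x; have D := cvgD (qC x) (sC x); exact: D.
move=> v a va _ [x /cell_pairP xE <-].
have [//|xv xa x1 x0] := xE.
have y0 b : b != a -> y b x = 0.
  by move=> ba; rewrite /y x0 ?ramp0.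
have qE : q x = y a x *: p a.
  by rewrite /q (bigD1 a) //= big1 ?addr0 // => b /y0->; rewrite scale0r.
have tE : \sum_b y b x * t v b = y a x * t v a.
  by rewrite (bigD1 a) //= big1 ?addr0 // => b /y0->; rewrite mul0r.
have gE : g x = q x + ramp (x (inl v)) *: (c v (y a x * t v a) - q x).
  rewrite /g (bigD1 v) //= tE big1 ?addr0 // => w wv.
  by rewrite x0 ?ramp0 ?scale0r.
rewrite gE qE /y; have [->|->] := ramp_or x1.
  by rewrite scale1r addrC subrK; eexists.
by rewrite scale1r mul1r cp // subrr scaler0 addr0 -(cp _ _ va); eexists.
Qed.

Lemma string_graph_drawing (R : realType) (G : graph) :
  string_graph R G ->
  exists2 g : {ptws subdivision G -> R} -> R * R,
    continuous g &
    forall e f : {set subdivision G}, sd_pairs (e, f) ->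
      g @` cell e `&` g @` cell f = set0.
Proof.
move=> [gamma [gammaC gammaE]].
have /choice[c cP] v : exists c : R -> R * R, continuous c /\ gamma v = range c.
  by have [c cC cE] := is_curve_range_line (gammaC v); exists c.
have /choice[p pP] (a : edge G) :
    exists p, forall v, v \in val a -> range (c v) p.
  have [v [w [vw aE aG]]] := edge_ends a.
  have [p []] := (gammaE v w vw).2 aG; rewrite (cP v).2 (cP w).2 => pv pw.
  by exists p => u; rewrite aE !inE => /orP[]/eqP->.
have /choice[t tP] (va : G * edge G) :
    exists t, va.1 \in val va.2 -> c va.1 t = p va.2.
  have [va12|] := boolP (va.1 \in val va.2); last by exists 0.
  by have [t _ tE] := pP _ _ va12; exists t.
have [g gC gS] := drawing_along_strings (c := c) (p := p)
  (t := fun v a => t (v, a)) (fun v => (cP v).1) (fun v a => tP (v, a)).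
exists g => // e f [v [w [a [b [[-> ->] va wb vw vwG]]]]].
apply/eqP; apply: contraNT vwG => /set0P[z [zv zw]].
apply: (gammaE v w vw).1; exists z; rewrite (cP v).2 (cP w).2.
by split; [exact: gS zv|exact: gS zw].
Qed.

(** * From a drawing to strings *)

Section Star.
Context {R : realType} {G : graph}.

(** The coordinate of [a] along [star_path v]: the spoke towards [a] is
    travelled out and back while [t] runs through the interval of length
    [1 / #|edge G|] whose position is the rank of [a].  All the edges of the graph receive an
    interval; during that of an edge which does not contain [v], the path rests
    at [v]. *)
Definition spoke (v : G) (a : edge G) (t : R) : R :=
  if v \in val a then tent (t * #|edge G|%:R - (enum_rank a)%:R) else 0.

Definition star_path (v : G) (t : R) : {ptws subdivision G -> R} :=
  fun u => match u with
    | inl w => if w == v then 1 - \sum_a spoke v a t else 0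
    | inr a => spoke v a t
    end.

Lemma spoke_continuous v a : continuous (spoke v a).
Proof.
rewrite /spoke; case: (v \in val a) => t; last exact: cvg_cst.
pose h (s : R) := s * #|edge G|%:R - (enum_rank a)%:R.
have hC : {for t, continuous h}.
  by apply: cvgB; [exact: cvgMr_tmp|exact: cvg_cst].
by apply: (continuous_comp hC); exact: tent_continuous.
Qed.

Lemma star_path_continuous v : continuous (star_path v).
Proof.
apply: continuous_ptws => -[w|a] /=; last exact: spoke_continuous.
have [_ t|_ t] := eqVneq w v; last exact: cvg_cst.
apply: cvgB; first exact: cvg_cst.
move: t; apply: continuous_big; first exact: add_continuous.
by move=> a _; exact: spoke_continuous.
Qed.

(** The rank is the integer part of [y]; hence at any time at most one spoke is
    being travelled. *)
Lemma rank_floor_inj (a b : edge G) (y : R) :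
  0 <= y - (enum_rank a)%:R < 1 -> 0 <= y - (enum_rank b)%:R < 1 -> a = b.
Proof.
move=> /andP[a0 a1] /andP[b0 b1]; apply: enum_rank_inj; apply: val_inj => /=.
apply/eqP; rewrite eqn_leq -!(ltnS (enum_rank _)) -!(ltr_nat R).
rewrite -(natr1 (enum_rank a)) -(natr1 (enum_rank b)).
by apply/andP; split; lra.
Qed.

Lemma spoke_neq0 v (a : edge G) t : spoke v a t != 0 ->
  v \in val a /\ 0 <= t * #|edge G|%:R - (enum_rank a)%:R < 1.
Proof.
rewrite /spoke; case: ifP => [va|]; last by rewrite eqxx.
by move=> /tent_neq0 /andP[/ltW-> ->].
Qed.

Lemma cell_star_path v (a : edge G) t : v \in val a ->
  (forall b, b != a -> spoke v b t = 0) ->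
  cell (sd_edge v a) (star_path v t).
Proof.
move=> va t0; apply/cell_pairP => //.
have -> : star_path v t (inl v) = 1 - spoke v a t.
  rewrite /= eqxx (bigD1 a) //= big1 ?addr0 // => b; exact: t0.
rewrite /= subrK /spoke va subr_ge0; split=> //; first exact: tent_le1.
  exact: tent_ge0.
case=> [w|b] uv ua /=.
  by rewrite ifN //; apply: contraNneq uv => ->.
by apply: t0; apply: contraNneq ua => ->.
Qed.

(** An edge [a0] at [v] is needed for the times at which the path rests at [v]:
    the point [v] then belongs to the segment [v a0]. *)
Lemma star_path_in v (a0 : edge G) t : v \in val a0 ->
  exists2 a : edge G, v \in val a & cell (sd_edge v a) (star_path v t).
Proof.
move=> va0; case: (pickP (fun a => spoke v a t != 0)) => [a at0|t0].
  have [va ha] := spoke_neq0 at0; exists a => //.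
  apply: cell_star_path => // b; apply: contraNeq => /spoke_neq0[_ hb].
  by apply/eqP; exact: rank_floor_inj hb ha.
exists a0 => //; apply: cell_star_path => // b _; exact/eqP/negbFE/t0.
Qed.

Lemma star_path_onto v (a : edge G) x : v \in val a ->
  cell (sd_edge v a) x -> exists2 t, t \in `[0, 1]%R & star_path v t = x.
Proof.
move=> va /cell_pairP xE; have [//|xv xa x1 x0] := xE.
set i : R := (enum_rank a)%:R; set N : R := #|edge G|%:R.
have i_ge0 : 0 <= i by exact: ler0n.
have iN : i + 1 <= N by rewrite natr1 ler_nat ltn_ord.
have N0 : N != 0 by apply: lt0r_neq0; lra.
(* The way out takes the first half of the interval of [a]. *)
exists ((i + x (inr a) / 2) / N).
  rewrite in_itv /= divr_ge0 ?ler_pdivrMr; lra.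
have spokeE b : spoke v b ((i + x (inr a) / 2) / N) = x (inr b).
  have [->|ba] := eqVneq b a.
    by rewrite /spoke va divfK // /i addrAC subrr add0r tent_half //; lra.
  rewrite (x0 (inr b)) //; apply/eqP; apply: contraNT ba => /spoke_neq0[_].
  rewrite divfK // => hb; apply/eqP; apply: rank_floor_inj hb _.
  by rewrite -/i; lra.
apply/funext => -[w|b] /=; last exact: spokeE.
under eq_bigr do rewrite spokeE.
have [->|wv] := eqVneq w v; last by rewrite x0.
rewrite (bigD1 a) //= big1; first by rewrite addr0; lra.
by move=> b ba; rewrite x0.
Qed.

Lemma star_is_curve (g : {ptws subdivision G -> R} -> R * R) v (a0 : edge G) :
  {within realization R (subdivision G), continuous g} -> v \in val a0 ->
  is_curve
    [set p | exists2 a : edge G, v \in val a & (g @` cell (sd_edge v a)) p].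
Proof.
move=> gC va0.
have pC : continuous (g \o star_path v).
  apply: continuous_comp_within gC => [|t]; first exact: star_path_continuous.
  right; have [a va ca] := star_path_in t va0; exists (sd_edge v a) => //.
  by apply/imset2P; exists a v.
suff -> :
    [set p | exists2 a : edge G, v \in val a & (g @` cell (sd_edge v a)) p] =
    (g \o star_path v) @` `[0, 1] by exact: is_curve_path.
apply/seteqP; split=> [_ [a va [x xa <-]]|_ [t _ <-]] /=.
  by have [t t01 <-] := star_path_onto va xa; exists t.
by have [a va ca] := star_path_in t va0; exists a => //; exists (star_path v t).
Qed.

End Star.

Lemma is_curve_point (R : realType) (p : R * R) : is_curve [set p].
Proof.
exists (fun=> p).
  by apply: continuous_subspaceT; exact: cst_continuous.
apply/seteqP; split=> [_ ->|_ [_ _ <-]] //.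
by exists 0 => //=; rewrite in_itv /= lexx ler01.
Qed.

Lemma drawing_string_graph (R : realType) (G : graph)
    (g : {ptws subdivision G -> R} -> R * R) :
  {within realization R (subdivision G), continuous g} ->
  (forall e f : {set subdivision G}, sd_pairs (e, f) ->
     g @` cell e `&` g @` cell f = set0) ->
  string_graph R G.
Proof.
move=> gC gP.
pose star (v : G) : set (R * R) :=
  [set p | exists2 a : edge G, v \in val a & (g @` cell (sd_edge v a)) p].
pose isolated (v : G) := forall a : edge G, v \notin val a.
have starC v : ~ isolated v -> is_curve (star v).
  by move=> /existsNP[a /negP/negPn va]; exact: star_is_curve gC va.
have /choice[M MP] v : exists M, forall p, star v p -> p.1 <= M.
  have [iv|/starC/is_curve_bounded//] := pselect (isolated v).
  by exists 0 => p [a va]; rewrite (negPf (iv a)) in va.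
(* [M u] bounds the first coordinate on the star of [u]; the offset by the rank
   of [v] keeps the points of distinct isolated vertices apart. *)
pose far (v : G) : R * R := (\sum_u `|M u| + (enum_rank v).+1%:R, 0).
have far_star v w : ~ star w (far v).
  move=> /MP /=; apply/negP; rewrite -ltNge; apply: (le_lt_trans (ler_norm _)).
  rewrite (bigD1 w) //= -addrA ltrDl ltr_wpDl ?ltr0Sn // sumr_ge0 //.
pose string v := if pselect (isolated v) then [set far v] else star v.
have stringI v : isolated v -> string v = [set far v].
  by rewrite /string; case: pselect.
have stringN v : ~ isolated v -> string v = star v.
  by rewrite /string; case: pselect.
exists string; split=> [v|v w vw].
  have [iv|nv] := pselect (isolated v).
    by rewrite stringI //; exact: is_curve_point.
  by rewrite stringN //; exact: starC.
split.
  have [iv|nv] := pselect (isolated v); have [iw|nw] := pselect (isolated w).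
  - rewrite (stringI v) // (stringI w) // => -[p [/= pv pw]].
    have /eqP := congr1 fst (etrans (esym pv) pw) => /=.
    rewrite (inj_eq (addrI _)) eqr_nat eqSS => /eqP/val_inj/enum_rank_inj.
    by move=> /vw.
  - rewrite (stringI v) // (stringN w) // => -[p [/= pv pw]].
    by rewrite pv in pw; have := far_star _ _ pw.
  - rewrite (stringN v) // (stringI w) // => -[p [/= pv pw]].
    by rewrite pw in pv; have := far_star _ _ pv.
  - rewrite (stringN v) // (stringN w) // => -[p [[a va pa] [b wb pb]]].
    apply: contrapT => /negP vwG.
    have : (g @` cell (sd_edge v a) `&` g @` cell (sd_edge w b)) p by [].
    by rewrite gP //; exists v, w, a, b.
move=> vwG; pose a : edge G := exist _ [set v; w]%SET vwG.
have va : v \in val a by rewrite /= !inE eqxx.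
have wa : w \in val a by rewrite /= !inE eqxx orbT.
have niso u : u \in val a -> ~ isolated u by move=> ua /(_ a); rewrite ua.
(* [x] is the point [a] of the realization. *)
pose x : {ptws subdivision G -> R} := fun u => (u == inr a)%:R.
have xS u : u \in val a -> star u (g x).
  move=> ua; exists a => //; exists x => //; apply/cell_pairP => //.
  by rewrite /x eqxx; split=> //; rewrite ?add0r // => y _ /negPf->.
exists (g x); rewrite (stringN v (niso _ va)) (stringN w (niso _ wa)).
by split; exact: xS.
Qed.

Theorem theorem3p6 (R : realType) (G : graph) :
  string_graph R G <->
  exists2 g : {ptws subdivision G -> R} -> R * R,
    {within realization R (subdivision G), continuous g} &
    forall e f : {set subdivision G}, sd_pairs (e, f) ->
      g @` cell e `&` g @` cell f = set0.
Proof.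
split=> [/string_graph_drawing[g gC gP]|[g gC gP]].
  by exists g => //; exact: continuous_subspaceT.
exact: drawing_string_graph gC gP.
Qed.
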